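(* Let $\mathfrak{A}$ be a unital $\mathrm{C}^*$-algebra and let $\Delta$ be a set of irreducible $*$-representations of $\mathfrak{A}$ which is separating for $\mathfrak{A}$. Assume that there is a positive element $t\in \mathfrak{A}$ and a finite-dimensional $*$-representation $\pi\in \Delta$ with the property \[ \min \operatorname{spec}(\pi(t))> \sup_{\sigma\in \Delta, \sigma\not\sim \pi} \|\sigma(t)\|. \] Then, the support projection of $\pi$ lies in $\mathfrak{A}$ and peaks strongly at $\pi$.
   Context: $\Delta$ is separating for $\mathfrak{A}$ if $\bigoplus_{\sigma\in\Delta}\sigma$ is injective. $\operatorname{spec}(T)$ is the spectrum of a bounded operator $T$. Two irreducible $*$-representations are weakly equivalent, written $\sigma\sim\pi$, if $\ker\sigma=\ker\pi$. Support projection: the bidual $\mathfrak{A}^{**}$ is a von Neumann algebra containing $\mathfrak{A}$ canonically. For a $*$-representation $\pi:\mathfrak{A}\to B(\mathcal{H}_\pi)$, the map $\pi^{**}:\mathfrak{A}^{**}\to B(\mathcal{H}_\pi)^{**}$ is a weak-$*$ continuous $*$-representation, and there is a central projection $\mathfrak{e}_\pi\in\mathfrak{A}^{**}$ with $\mathfrak{e}_\pi\mathfrak{A}^{**}=\ker\pi^{**}=(\ker\pi)^{\perp\perp}$. The support projection of $\pi$ is $\mathfrak{s}_\pi=I-\mathfrak{e}_\pi$. An element $T\in\mathbb{M}_n(\mathfrak{A})$ peaks strongly at an irreducible $*$-representation $\pi$ of $\mathfrak{A}$ if $\|\pi^{(n)}(T)\|>\sup_\sigma\|\sigma^{(n)}(T)\|$,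 the supremum being over all irreducible $*$-representations $\sigma$ of $\mathfrak{A}$ not unitarily equivalent to $\pi$; here $\sigma^{(n)}$ is the entrywise ampliation of $\sigma$ to $\mathbb{M}_n(\mathfrak{A})$. *)

(* Defs.v *)
From HB Require Import structures.
From mathcomp Require Import all_boot all_order all_algebra.
From mathcomp Require Import complex.
From mathcomp Require Import all_classical all_reals all_analysis.

Set Implicit Arguments.
Unset Strict Implicit.
Unset Printing Implicit Defensive.

Import Order.TTheory GRing.Theory Num.Theory.
Import numFieldNormedType.Exports.

Local Open Scope classical_set_scope.
Local Open Scope complex_scope.
Local Open Scope ring_scope.

(* The library's norm on a complex normed module takes values in [R[i]];
   [rnorm] is the same norm, seen in [R] (see [rnormE]). *)
Definition rnorm (R : realType) (V : normedModType R[i]) (x : V) : R :=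
  complex.Re `|x|.

Section RealNorm.
Variables (R : realType) (V : normedModType R[i]).
Implicit Types x y : V.

Lemma rnormE x : `|x| = (rnorm x)%:C.
Proof.
have := normr_ge0 x; rewrite /rnorm; case: `|x| => a b.
by rewrite lecE /= => /andP[/eqP -> _].
Qed.

Lemma rnorm_ge0 x : 0 <= rnorm x.
Proof. by rewrite -ler0c -rnormE. Qed.

Lemma rnorm0 : rnorm (0 : V) = 0.
Proof. by rewrite /rnorm normr0. Qed.

Lemma rnorm0_eq0 x : rnorm x = 0 -> x = 0.
Proof. by move=> x0; apply/normr0_eq0; rewrite rnormE x0. Qed.

Lemma rnormD x y : rnorm (x + y) <= rnorm x + rnorm y.
Proof. by rewrite -lecR rmorphD /= -!rnormE ler_normD. Qed.

Lemma rnormN x : rnorm (- x) = rnorm x.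
Proof. by rewrite /rnorm normrN. Qed.

Lemma rnormB x y : rnorm (x - y) = rnorm (y - x).
Proof. by rewrite /rnorm distrC. Qed.

Lemma rnorm_distD z x y : rnorm (x - y) <= rnorm (x - z) + rnorm (z - y).
Proof. by rewrite -lecR rmorphD /= -!rnormE ler_distD. Qed.

Lemma rnormZ (l : R[i]) x : rnorm (l *: x) = rnorm (l : R[i]^o) * rnorm x.
Proof. by apply/complexI; rewrite rmorphM /= -!rnormE normrZ. Qed.

End RealNorm.

Lemma rnormC (R : realType) (l : R[i]) :
  rnorm (l^*%C : R[i]^o) = rnorm (l : R[i]^o).
Proof. by case: l => a b; rewrite /rnorm /= sqrrN. Qed.

Section BoundedMaps.
Variables (R : realType) (V W : normedModType R[i]).

Definition bounded_linear : {pred V -> W} :=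
  [pred f | `[< linear f /\
                exists M : R, forall x, rnorm (f x) <= M * rnorm x >]].

Record bounded_map := BoundedMap {
  bounded_fun :> V -> W ;
  bounded_funP : bounded_fun \in bounded_linear
}.

HB.instance Definition _ := [isSub for bounded_fun].
HB.instance Definition _ := [Choice of bounded_map by <:].

Lemma bounded_linear_submod : submod_closed bounded_linear.
Proof.
split=> [|a f g].
  apply/asboolP; split=> [b x y|]; first by rewrite /= scaler0 addr0.
  by exists 0 => x; rewrite mul0r /= rnorm0.
move=> /asboolP[fL [M fM]] /asboolP[gL [N gN]]; apply/asboolP; split.
  move=> b x y; rewrite !fctE fL gL /= !scalerDr !scalerA mulrC.
  by rewrite addrACA.
exists (rnorm (a : R[i]^o) * M + N) => x; rewrite mulrDl -mulrA.
rewrite (le_trans (rnormD _ _))// lerD//= rnormZ.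
by rewrite ler_wpM2l ?rnorm_ge0.
Qed.

HB.instance Definition _ := GRing.isSubmodClosed.Build _ _ bounded_linear
  bounded_linear_submod.
HB.instance Definition _ := [SubChoice_isSubLmodule of bounded_map by <:].

Lemma bounded_map_linear (f : bounded_map) : linear f.
Proof. by have /asboolP[] := bounded_funP f. Qed.

HB.instance Definition _ (f : bounded_map) :=
  GRing.isLinear.Build R[i] V W _ (bounded_fun f) (bounded_map_linear f).

Lemma bounded_mapP (f g : bounded_map) : f =1 g <-> f = g.
Proof. by split=> [fg|->//]; apply/val_inj/funext. Qed.

Definition mk_bounded (f : V -> W) (fL : linear f) (M : R)
    (fM : forall x, rnorm (f x) <= M * rnorm x) : bounded_map :=
  BoundedMap (asboolT (conj fL (ex_intro _ M fM))).

Definition opnorm (f : bounded_map) : R :=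
  sup [set rnorm (f x) | x in [set x | rnorm x <= 1]].

Lemma opnorm_has_sup (f : bounded_map) :
  has_sup [set rnorm (f x) | x in [set x | rnorm x <= 1]].
Proof.
split; first by exists (rnorm (f 0)), 0 => //=; rewrite rnorm0 ler01.
have /asboolP[_ [M fM]] := bounded_funP f.
exists `|M| => _ [x /= x1 <-]; rewrite (le_trans (fM _))//.
by rewrite (le_trans (ler_wpM2r (rnorm_ge0 x) (ler_norm M)))// ler_piMr.
Qed.

Lemma opnorm_ge0 (f : bounded_map) : 0 <= opnorm f.
Proof.
apply: (@le_trans _ _ (rnorm (f 0))); first exact: rnorm_ge0.
by apply: sup_upper_bound; [exact: opnorm_has_sup|
  exists 0 => //=; rewrite rnorm0 ler01].
Qed.

Lemma opnorm_bound (f : bounded_map) x : rnorm (f x) <= opnorm f * rnorm x.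
Proof.
have [x0|x0] := eqVneq (rnorm x) 0.
  by rewrite (rnorm0_eq0 x0) linear0 !rnorm0 mulr0.
have xp : 0 < rnorm x by rewrite lt_def x0 rnorm_ge0.
have nC : rnorm ((rnorm x)^-1%:C : R[i]^o) = (rnorm x)^-1.
  by rewrite /rnorm /= expr0n addr0 sqrtr_sqr ger0_norm// invr_ge0 rnorm_ge0.
rewrite -ler_pdivrMr//.
have -> : rnorm (f x) / rnorm x = rnorm (f ((rnorm x)^-1%:C *: x)).
  by rewrite linearZ rnormZ nC mulrC.
apply: sup_upper_bound; first exact: opnorm_has_sup.
by eexists => //=; rewrite rnormZ nC mulVf.
Qed.

Lemma opnorm_le (f : bounded_map) (M : R) : 0 <= M ->
  (forall x, rnorm (f x) <= M * rnorm x) -> opnorm f <= M.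
Proof.
move=> M0 fM; apply: ge_sup; first by have [] := opnorm_has_sup f.
by move=> _ [x /= x1 <-]; rewrite (le_trans (fM _))// ler_piMr.
Qed.

Let norm (f : bounded_map) : R[i] := (opnorm f)%:C.

Let normD f g : norm (f + g) <= norm f + norm g.
Proof.
rewrite -rmorphD lecR; apply: opnorm_le => [|x].
  by rewrite addr_ge0 ?opnorm_ge0.
by rewrite (le_trans (rnormD _ _))// mulrDl lerD// opnorm_bound.
Qed.

Let normZ (l : R[i]) f : norm (l *: f) = `|l| * norm f.
Proof.
rewrite -[`|l|]/(`|l : R[i]^o|) rnormE -rmorphM; congr (_ %:C).
have le (k : R[i]) g : opnorm (k *: g) <= rnorm (k : R[i]^o) * opnorm g.
  apply: opnorm_le => [|x]; first by rewrite mulr_ge0 ?rnorm_ge0 ?opnorm_ge0.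
  by rewrite -mulrA /= rnormZ ler_wpM2l ?rnorm_ge0 ?opnorm_bound.
apply/eqP; rewrite eq_le le /=.
have [->|l0] := eqVneq l 0; first by rewrite rnorm0 mul0r opnorm_ge0.
have lp : 0 < rnorm (l : R[i]^o).
  rewrite lt_def rnorm_ge0 andbT; apply: contra_neq l0.
  exact: (@rnorm0_eq0 _ (R[i]^o)).
rewrite -ler_pdivlMl//; have := le l^-1 (l *: f).
rewrite scalerA mulVf// scale1r.
suff -> : rnorm (l^-1 : R[i]^o) = (rnorm (l : R[i]^o))^-1 by [].
by apply: complexI; rewrite fmorphV /= -!rnormE normfV.
Qed.

Let norm0_eq0 f : norm f = 0 -> f = 0.
Proof.
move=> /complexI f0; apply/bounded_mapP => x; apply/rnorm0_eq0/eqP.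
by rewrite eq_le rnorm_ge0 (le_trans (opnorm_bound f x))// f0 mul0r.
Qed.

HB.instance Definition _ :=
  Lmodule_isNormed.Build R[i] bounded_map normD normZ norm0_eq0.

Lemma rnorm_opnorm (f : bounded_map) : rnorm f = opnorm f.
Proof. by []. Qed.

Lemma rnorm_bound (f : bounded_map) x : rnorm (f x) <= rnorm f * rnorm x.
Proof. exact: opnorm_bound. Qed.

Lemma rnorm_le (f : bounded_map) (M : R) : 0 <= M ->
  (forall x, rnorm (f x) <= M * rnorm x) -> rnorm f <= M.
Proof. exact: opnorm_le. Qed.

End BoundedMaps.

(* The ring operations of a C*-algebra are fields of the mixin instead of being
   inherited from [GRing.Algebra]: the hierarchy has no join of rings and
   normed modules other than number domains. *)
HB.mixin Record isCStarAlgebra (R : realType) A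
    & CompleteNormedModule R[i] A := {
  cunit : A ;
  cmul : A -> A -> A ;
  star : A -> A ;
  cmulA : associative cmul ;
  cmul1r : left_id cunit cmul ;
  cmulr1 : right_id cunit cmul ;
  cmulDl : left_distributive cmul +%R ;
  cmulDr : right_distributive cmul +%R ;
  cmulZl : forall (l : R[i]) (x y : A), cmul (l *: x) y = l *: cmul x y ;
  cmulZr : forall (l : R[i]) (x y : A), cmul x (l *: y) = l *: cmul x y ;
  starK : involutive star ;
  starD : forall x y : A, star (x + y) = star x + star y ;
  starZ : forall (l : R[i]) (x : A), star (l *: x) = l^*%C *: star x ;
  starM : forall x y : A, star (cmul x y) = cmul (star y) (star x) ;
  rnormM : forall x y : A, rnorm (cmul x y) <= rnorm x * rnorm y ;
  cstar_identity : forall x : A, rnorm (cmul (star x) x) = rnorm x ^+ 2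
}.

#[short(type="cstarAlgType")]
HB.structure Definition CStarAlgebra (R : realType) :=
  {A of isCStarAlgebra R A & CompleteNormedModule R[i] A}.

HB.mixin Record isHilbert (R : realType) H & CompleteNormedModule R[i] H := {
  inner : {dot H for (@conjc R)} ;
  inner_rnorm : forall x : H, inner x x = (rnorm x ^+ 2)%:C
}.

#[short(type="hilbertType")]
HB.structure Definition Hilbert (R : realType) :=
  {H of isHilbert R H & CompleteNormedModule R[i] H}.

Section CStarTheory.
Variables (R : realType) (A : cstarAlgType R).
Implicit Types a b x y : A.

Lemma cmulBl x y z : cmul (x - y) z = cmul x z - cmul y z :> A.
Proof. by rewrite -(scaleN1r y) cmulDl cmulZl scaleN1r. Qed.

Lemma cmulBr x y z : cmul x (y - z) = cmul x y - cmul x z :> A.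
Proof. by rewrite -(scaleN1r z) cmulDr cmulZr scaleN1r. Qed.

Lemma starB x y : star (x - y) = star x - star y.
Proof.
have N1 : ((-1 : R[i])^*%C) = -1 by rewrite rmorphN rmorph1.
by rewrite -(scaleN1r y) starD starZ N1 scaleN1r.
Qed.

Lemma star1 : star cunit = cunit :> A.
Proof.
by rewrite -[RHS]starK -[star cunit in RHS]cmul1r starM starK cmul1r.
Qed.

Lemma rnorm_star x : rnorm (star x) = rnorm x.
Proof.
have le y : rnorm y <= rnorm (star y).
  have [->|y0] := eqVneq (rnorm y) 0; first exact: rnorm_ge0.
  have yp : 0 < rnorm y by rewrite lt_def y0 rnorm_ge0.
  by rewrite -(ler_pM2r yp) -expr2 -cstar_identity rnormM.
by apply/eqP; rewrite eq_le le -{2}(starK x) le.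
Qed.

Lemma cauchy_lim (V : completeNormedModType R[i]) (u : nat -> V) (c q : R) :
  0 <= q -> q < 1 ->
  (forall n m, (n <= m)%N -> rnorm (u n - u m) <= c * q ^+ n) ->
  exists l, forall e : R, 0 < e ->
    exists N, forall n, (N <= n)%N -> rnorm (u n - l) < e.
Proof.
move=> q0 q1 uc.
have small (e : R) : 0 < e -> exists N, forall n, (N <= n)%N -> c * q ^+ n < e.
  move=> e0; have : (fun n => c * q ^+ n) @ \oo --> (0 : R).
    rewrite -(mulr0 c); apply: cvgMr; rewrite /=.
    by apply: cvg_expr; rewrite ger0_norm.
  move=> /cvgrPdist_lt/(_ e e0)[N _ Ne]; exists N => n /Ne.
  by rewrite sub0r normrN; apply: le_lt_trans; exact: ler_norm.
have ballE (e : R[i]) (x y : V) : 0 < e ->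
    ball x e y = (rnorm (x - y) < complex.Re e).
  rewrite -ball_normE /= rnormE; case: e => a b.
  by rewrite !ltcE /= => /andP[/eqP-> _]; rewrite eqxx.
have : cvgn u.
  apply/cauchy_cvgP; apply/cauchy_ballP => e e0; near_simpl.
  have eR : 0 < complex.Re e by move: e0; rewrite ltcE => /andP[].
  have [N Ne] := small _ eR.
  exists ([set n | (N <= n)%N], [set n | (N <= n)%N]) => /=.
    by split; exists N.
  move=> [n m] /= [Nn Nm]; rewrite ballE//.
  case/orP: (leq_total n m) => nm.
    by rewrite (le_lt_trans (uc _ _ nm))// Ne.
  by rewrite rnormB (le_lt_trans (uc _ _ nm))// Ne.
move=> /cvg_ex[l ul]; exists l => e e0.
have /cvg_ballP/(_ e%:C) := ul; rewrite ltcR => /(_ e0)[N _ Ne].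
by exists N => n /Ne /=; rewrite ballE ?ltcR// rnormB.
Qed.

(* A square root of 1 - x, as 1 - y with y the fixed point of
   y |-> (x + y^2) / 2. *)
Lemma cstar_sqrt x (r : R) : r < 1 -> rnorm x <= r -> star x = x ->
  exists2 b, star b = b & cmul b b = cunit - x.
Proof.
move=> r1 xr xs.
have r0 : 0 <= r by rewrite (le_trans (rnorm_ge0 x)).
pose h : R[i] := (2^-1 : R)%:C.
have hE : rnorm (h : R[i]^o) = 2^-1.
  by rewrite /rnorm /= expr0n addr0 sqrtr_sqr ger0_norm.
have hs : h^*%C = h by rewrite /h /= oppr0.
have hh : h + h = 1.
  by rewrite /h -rmorphD /= [2^-1 + _](_ : _ = 1)// [RHS]splitr !mul1r.
pose f y := h *: (x + cmul y y).
have fr y : rnorm y <= r -> rnorm (f y) <= r.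
  move=> yr; rewrite /f rnormZ hE ler_pdivrMl// mulr2n mulrDl mul1r.
  rewrite (le_trans (rnormD _ _))// lerD// (le_trans (rnormM _ _))//.
  by rewrite (le_trans (ler_pM _ _ yr yr)) ?rnorm_ge0// ler_piMr// ltW.
have fl y z : rnorm y <= r -> rnorm z <= r ->
    rnorm (f y - f z) <= r * rnorm (y - z).
  move=> yr zr; rewrite /f -scalerBr opprD addrACA subrr add0r.
  have -> : cmul y y - cmul z z = cmul y (y - z) + cmul (y - z) z.
    by rewrite cmulBl cmulBr addrA subrK.
  rewrite rnormZ hE ler_pdivrMl// (le_trans (rnormD _ _))//.
  rewrite mulr2n mulrDl mul1r lerD// (le_trans (rnormM _ _))//.
    by rewrite ler_wpM2r ?rnorm_ge0.
  by rewrite mulrC ler_wpM2r ?rnorm_ge0.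
pose u n := iter n f 0.
have ur n : rnorm (u n) <= r.
  by elim: n => [|n ih]; rewrite /= ?rnorm0//; exact: fr.
have u1 n m : rnorm (u n - u (n + m)%N) <= r ^+ n * (2 * r).
  elim: n => [|n ih].
    rewrite expr0 mul1r mulr2n mulrDl mul1r (le_trans (rnormD _ _))//.
    by rewrite rnormN lerD.
  rewrite addSn /= (le_trans (fl _ _ (ur _) (ur _)))// exprS -mulrA.
  by rewrite ler_wpM2l.
have [y yl] : exists l, forall e : R, 0 < e ->
    exists N, forall n, (N <= n)%N -> rnorm (u n - l) < e.
  apply: (@cauchy_lim _ u (2 * r) r) => // n m nm.
  by rewrite mulrC -(subnKC nm).
have yr : rnorm y <= r.
  apply/ler_addgt0Pr => e /yl[N /(_ N (leqnn _)) Ne].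
  rewrite -(subrK (u N) y) addrC (le_trans (rnormD _ _))// lerD//.
  by rewrite rnormB ltW.
have yf : f y = y.
  apply/eqP; rewrite -subr_eq0; apply/eqP/rnorm0_eq0/eqP.
  rewrite eq_le rnorm_ge0 andbT; apply/ler_addgt0Pr => e e0; rewrite add0r.
  have e2 : 0 < e / 2 by rewrite divr_gt0.
  have [N Ne] := yl _ e2.
  rewrite (le_trans (rnorm_distD (u N.+1) _ _))// (splitr e) lerD//; last first.
    by rewrite ltW// Ne.
  rewrite (le_trans (fl _ _ yr (ur _)))// rnormB.
  rewrite (le_trans _ (ltW (Ne N (leqnn _))))// ler_piMl ?rnorm_ge0//.
  exact: ltW.
have ys : star y = y.
  have sf : f (star y) = star y by rewrite -{2}yf /f starZ hs starD xs starM.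
  have := fl _ _ (eq_rect_r (fun s => s <= r) yr (rnorm_star y)) yr.
  rewrite sf yf => d_le; apply/eqP; rewrite -subr_eq0; apply/eqP/rnorm0_eq0.
  apply/eqP; apply: contraLR d_le => ne.
  have d0 : 0 < rnorm (star y - y) by rewrite lt_def ne rnorm_ge0.
  by rewrite -ltNge gtr_pMl.
exists (cunit - y); first by rewrite starB star1 ys.
rewrite cmulBl cmul1r cmulBr cmulr1 opprB.
have -> : x = (y + y) - cmul y y.
  have <- : h *: (x + cmul y y) + h *: (x + cmul y y) = y + y.
    by rewrite -/(f y) yf.
  by rewrite -scalerDl hh scale1r addrK.
by rewrite opprB opprD -addrA; congr (_ + _); rewrite addrCA.
Qed.

End CStarTheory.

Section Bidual.
Variables (R : realType) (V W : normedModType R[i]).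

Definition dual (U : normedModType R[i]) : normedModType R[i] :=
  bounded_map U R[i]^o.

Definition bidual (U : normedModType R[i]) : normedModType R[i] :=
  dual (dual U).

Lemma bounded_eval_linear (v : V) : linear (fun phi : dual V => phi v).
Proof. by []. Qed.

Lemma bounded_eval_le (v : V) (phi : dual V) :
  rnorm (phi v) <= rnorm v * rnorm phi.
Proof. by rewrite mulrC; exact: rnorm_bound. Qed.

Definition bidual_embedding (v : V) : bidual V :=
  mk_bounded (bounded_eval_linear v) (bounded_eval_le v).

Variable T : bounded_map V W.

Lemma comp_linear (psi : dual W) : linear (psi \o T).
Proof. by move=> l x y; rewrite /= !linearP. Qed.

Lemma comp_le (psi : dual W) x :
  rnorm ((psi \o T) x) <= rnorm psi * rnorm T * rnorm x.
Proof.
rewrite (le_trans (rnorm_bound _ _))// -mulrA ler_wpM2l ?rnorm_ge0//.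
exact: rnorm_bound.
Qed.

Definition transpose_fun (psi : dual W) : dual V :=
  mk_bounded (comp_linear psi) (comp_le psi).

Lemma transpose_linear : linear transpose_fun.
Proof. by move=> l f g; apply/bounded_mapP => x. Qed.

Lemma transpose_le psi : rnorm (transpose_fun psi) <= rnorm T * rnorm psi.
Proof.
apply: rnorm_le => [|x]; first by rewrite mulr_ge0 ?rnorm_ge0.
by rewrite [rnorm T * _]mulrC comp_le.
Qed.

Definition transpose : bounded_map (dual W) (dual V) :=
  mk_bounded transpose_linear transpose_le.

End Bidual.

Definition bitranspose (R : realType) (V W : normedModType R[i])
    (T : bounded_map V W) : bounded_map (bidual V) (bidual W) :=
  transpose (transpose T).

(* The bidual of a C*-algebra, with its (first) Arens product
     (F . G)(phi) = F (a |-> G (b |-> phi (a b)))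
   and the involution F^*(phi) = (F (a |-> (phi a^* )^* ))^*.  C*-algebras being
   Arens regular, this is the von Neumann algebra structure of the bidual. *)
Section Arens.
Variables (R : realType) (A : cstarAlgType R).
Implicit Types (a b : A) (phi : dual A) (F G H : bidual A).

Lemma dual_shift_linear phi a : linear (fun b => phi (cmul a b)).
Proof. by move=> l x y; rewrite cmulDr cmulZr linearP. Qed.

Lemma dual_shift_le phi a b :
  rnorm (phi (cmul a b)) <= rnorm phi * rnorm a * rnorm b.
Proof.
rewrite (le_trans (rnorm_bound _ _))// -mulrA ler_wpM2l ?rnorm_ge0//.
exact: rnormM.
Qed.

Definition dual_shift phi a : dual A :=
  mk_bounded (dual_shift_linear phi a) (dual_shift_le phi a).

Lemma rnorm_dual_shift phi a : rnorm (dual_shift phi a) <= rnorm phi * rnorm a.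
Proof.
by apply: rnorm_le; [rewrite mulr_ge0 ?rnorm_ge0|exact: dual_shift_le].
Qed.

Lemma dual_act_linear G phi : linear (fun a => G (dual_shift phi a)).
Proof.
move=> l x y; rewrite -linearP; congr (G _); apply/bounded_mapP => b /=.
by rewrite cmulDl cmulZl linearP.
Qed.

Lemma dual_act_le G phi a :
  rnorm (G (dual_shift phi a)) <= rnorm G * rnorm phi * rnorm a.
Proof.
rewrite (le_trans (rnorm_bound _ _))// -mulrA ler_wpM2l ?rnorm_ge0//.
exact: rnorm_dual_shift.
Qed.

Definition dual_act G phi : dual A :=
  mk_bounded (dual_act_linear G phi) (dual_act_le G phi).

Lemma rnorm_dual_act G phi : rnorm (dual_act G phi) <= rnorm G * rnorm phi.
Proof.
by apply: rnorm_le; [rewrite mulr_ge0 ?rnorm_ge0|exact: dual_act_le].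
Qed.

Lemma arens_linear F G : linear (fun phi => F (dual_act G phi)).
Proof.
move=> l phi psi; rewrite -linearP; congr (F _); apply/bounded_mapP => a /=.
have -> : dual_shift (l *: phi + psi) a
    = l *: dual_shift phi a + dual_shift psi a by apply/bounded_mapP.
by rewrite linearP.
Qed.

Lemma arens_le F G phi :
  rnorm (F (dual_act G phi)) <= rnorm F * rnorm G * rnorm phi.
Proof.
rewrite (le_trans (rnorm_bound _ _))// -mulrA ler_wpM2l ?rnorm_ge0//.
exact: rnorm_dual_act.
Qed.

Definition arens F G : bidual A := mk_bounded (arens_linear F G) (arens_le F G).

Lemma dual_star_linear phi : linear (fun a => (phi (star a))^*%C : R[i]^o).
Proof.
move=> l x y; rewrite starD starZ linearP rmorphD /=.
by rewrite /GRing.scale /= rmorphM /= conjcK.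
Qed.

Lemma dual_star_le phi a :
  rnorm ((phi (star a))^*%C : R[i]^o) <= rnorm phi * rnorm a.
Proof. by rewrite rnormC -(rnorm_star a); exact: rnorm_bound. Qed.

Definition dual_star phi : dual A :=
  mk_bounded (dual_star_linear phi) (dual_star_le phi).

Lemma bidual_star_linear F :
  linear (fun phi => (F (dual_star phi))^*%C : R[i]^o).
Proof.
move=> l phi psi.
have -> : dual_star (l *: phi + psi) = l^*%C *: dual_star phi + dual_star psi.
  apply/bounded_mapP => a /=.
  by rewrite /GRing.scale /= rmorphD rmorphM.
rewrite linearP rmorphD /=.
by rewrite /GRing.scale /= rmorphM /= conjcK.
Qed.

Lemma bidual_star_le F phi :
  rnorm ((F (dual_star phi))^*%C : R[i]^o) <= rnorm F * rnorm phi.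
Proof.
rewrite rnormC (le_trans (rnorm_bound _ _))// ler_wpM2l ?rnorm_ge0//.
by apply: rnorm_le; [exact: rnorm_ge0|exact: dual_star_le].
Qed.

Definition bidual_star F : bidual A :=
  mk_bounded (bidual_star_linear F) (bidual_star_le F).

Definition central_projection F :=
  [/\ arens F F = F, bidual_star F = F & forall G, arens F G = arens G F].

Lemma arensA : associative arens.
Proof.
move=> F G H; apply/bounded_mapP => phi /=; congr (F _).
apply/bounded_mapP => a /=; congr (G _); apply/bounded_mapP => b /=.
by congr (H _); apply/bounded_mapP => c /=; rewrite cmulA.
Qed.

Lemma arens1 F : arens F (bidual_embedding cunit) = F.
Proof.
apply/bounded_mapP => phi /=; congr (F _); apply/bounded_mapP => a /=.
by rewrite cmulr1.
Qed.

End Arens.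

Record starRep (R : realType) (A : cstarAlgType R) := StarRep {
  rep_space : hilbertType R ;
  rep_fun :> {linear A -> bounded_map rep_space rep_space} ;
  repM : forall a b x, rep_fun (cmul a b) x = rep_fun a (rep_fun b x) ;
  rep_star : forall a x y,
    inner (rep_fun (star a) x) y = inner x (rep_fun a y)
}.

Section Representations.
Variables (R : realType) (A : cstarAlgType R).
Implicit Types (s pi : starRep A) (a : A).

Lemma rep_unit_le s x : rnorm (s cunit x) <= rnorm x.
Proof.
have e : inner (s cunit x) x = inner (s cunit x) (s cunit x).
  by rewrite -rep_star star1 -repM cmul1r.
have e' : inner x (s cunit x) = inner (s cunit x) (s cunit x).
  by rewrite -rep_star star1 e.
have : (0 : R[i]) <= (rnorm (x - s cunit x) ^+ 2)%:C by rewrite ler0c sqr_ge0.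
rewrite -inner_rnorm linearBl !linearBr /= e e' subrr subr0 subr_ge0.
by rewrite !inner_rnorm lecR ler_sqr ?nnegrE ?rnorm_ge0.
Qed.

Lemma rep_le1 s a x : rnorm a < 1 -> rnorm (s a x) <= rnorm x.
Proof.
move=> a1.
have [|||b bs bb] := @cstar_sqrt _ A (cmul (star a) a) (rnorm a ^+ 2).
- by rewrite expr_lt1 ?rnorm_ge0.
- by rewrite cstar_identity.
- by rewrite starM starK.
have : (0 : R[i]) <= (rnorm (s b x) ^+ 2)%:C by rewrite ler0c sqr_ge0.
have sB : s (cunit - cmul (star a) a) x = s cunit x - s (star a) (s a x).
  by rewrite linearB -repM.
rewrite -inner_rnorm -rep_star bs -repM bb sB linearBl /= rep_star subr_ge0.
have -> : inner (s cunit x) x = inner (s cunit x) (s cunit x).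
  by rewrite -rep_star star1 -repM cmul1r.
rewrite !inner_rnorm lecR ler_sqr ?nnegrE ?rnorm_ge0// => /le_trans; apply.
exact: rep_unit_le.
Qed.

Lemma rep_contractive s a x : rnorm (s a x) <= rnorm a * rnorm x.
Proof.
apply/ler_addgt0Pr => e e0.
pose d := e / (1 + rnorm x).
have x1 : 0 < 1 + rnorm x by rewrite ltr_pwDl ?rnorm_ge0.
have d0 : 0 < d by rewrite divr_gt0.
have N0 : 0 < rnorm a + d by rewrite ltr_wpDl ?rnorm_ge0.
have cE : rnorm ((rnorm a + d)^-1%:C : R[i]^o) = (rnorm a + d)^-1.
  by rewrite /rnorm /= expr0n addr0 sqrtr_sqr ger0_norm// invr_ge0 ltW.
have := @rep_le1 s ((rnorm a + d)^-1%:C *: a) x.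
have -> : s ((rnorm a + d)^-1%:C *: a) x = (rnorm a + d)^-1%:C *: s a x.
  by rewrite linearZ.
rewrite !rnormZ cE ltr_pdivrMl// ler_pdivrMl// mulr1 ltrDl.
move=> /(_ d0)/le_trans; apply.
rewrite mulrDl lerD2l /d -mulrA ler_piMr ?(ltW e0)// ler_pdivrMl// mulr1.
by rewrite lerDr.
Qed.

Lemma rep_le s a : rnorm (s a) <= 1 * rnorm a.
Proof.
by rewrite mul1r; apply: rnorm_le; [exact: rnorm_ge0|exact: rep_contractive].
Qed.

(* A representation is automatically bounded, which makes its second
   transpose pi^** available. *)
Definition rep_map s :
    bounded_map A (bounded_map (rep_space s) (rep_space s)) :=
  mk_bounded (fun l => linearP s l) (rep_le s).

(* Representations need not preserve units; irreducible ones do. *)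
Definition irreducible s :=
  (exists a, s a != 0) /\
  forall M : set (rep_space s), closed M -> M 0 ->
    (forall (l : R[i]) x y, M x -> M y -> M (l *: x + y)) ->
    (forall a x, M x -> M (s a x)) ->
    M = [set 0] \/ M = setT.

Definition finite_dimensional s :=
  exists n (e : 'I_n -> rep_space s),
    forall x, exists c : 'I_n -> R[i], x = \sum_(i < n) c i *: e i.

Definition weakly_equivalent s pi := [set a | s a = 0] = [set a | pi a = 0].

Definition unitarily_equivalent s pi :=
  exists U : {linear rep_space s -> rep_space pi},
    [/\ bijective U,
        forall x y, inner (U x) (U y) = inner x y &
        forall a x, U (s a x) = pi a (U x)].

(* The support projection I - e, with e the central projection such that
   e A^** = ker pi^**. *)
Definition is_support_projection pi (F : bidual A) :=
  exists e : bidual A,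
    [/\ central_projection e,
        [set arens e G | G in setT] =
          [set G | bitranspose (rep_map pi) G = 0] &
        F = bidual_embedding cunit - e].

Lemma support_projection_unique pi F G :
  is_support_projection pi F -> is_support_projection pi G -> F = G.
Proof.
move=> [e [[ee _ ec] eK ->]] [f [[ff _ fc] fK ->]]; congr (_ - _).
have [G1 _ fG] : [set arens f G | G in setT] e by rewrite fK -eK; exists e.
have [G2 _ eG] : [set arens e G | G in setT] f by rewrite eK -fK; exists f.
have fe : arens f e = e by rewrite -fG arensA ff.
by rewrite -fe fc -eG arensA ee.
Qed.

Definition l2_norm n (H : hilbertType R) (x : 'I_n -> H) : R :=
  Num.sqrt (\sum_(i < n) rnorm (x i) ^+ 2).

Definition ampliation s n (T : 'M[A]_n) (x : 'I_n -> rep_space s)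
    : 'I_n -> rep_space s :=
  fun i => \sum_(j < n) s (T i j) (x j).

(* The operator norm of the ampliation, acting on the n-fold Hilbert sum
   of its space. *)
Definition ampliation_norm s n (T : 'M[A]_n) : R :=
  sup [set l2_norm (ampliation T x) |
    x in [set x : 'I_n -> rep_space s | l2_norm x <= 1]].

(* The supremum is taken in the extended reals: it is -oo over the empty set. *)
Definition peaks_strongly n (T : 'M[A]_n) pi :=
  (ereal_sup [set r | exists s, [/\ irreducible s,
                                   ~ unitarily_equivalent s pi &
                                   r = (ampliation_norm s T)%:E]]
   < (ampliation_norm pi T)%:E)%E.

End Representations.

(* The direct sum of the representations in Delta, on the Hilbert sum of their
   spaces.  Representations live in a universe too large for the library's
   [set], [choiceType] and [esum]: collections of representations are plain
   predicates, and a family is square-summable when the finite sums of its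
   squared norms are bounded. *)
Section DirectSum.
Variables (R : realType) (A : cstarAlgType R) (Delta : starRep A -> Prop).

Definition square_summable (h : forall s : {s | Delta s}, rep_space (sval s)) :=
  exists M : R, forall n (i : 'I_n -> {s | Delta s}),
    (forall j k, i j = i k -> j = k) ->
    \sum_(j < n) rnorm (h (i j)) ^+ 2 <= M.

Definition direct_sum_space := {h | square_summable h}.

Lemma direct_sum_subproof (a : A) (h : direct_sum_space) :
  square_summable (fun s => sval s a (sval h s)).
Proof.
case: h => h [M hM]; exists (rnorm a ^+ 2 * M) => n i inj_i.
apply: (@le_trans _ _ (rnorm a ^+ 2 * \sum_(j < n) rnorm (h (i j)) ^+ 2)).
  rewrite mulr_sumr; apply: ler_sum => j _; rewrite -exprMn.
  by rewrite ler_sqr ?nnegrE ?mulr_ge0 ?rnorm_ge0 ?rep_contractive.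
by rewrite ler_wpM2l ?sqr_ge0 ?hM.
Qed.

Definition direct_sum (a : A) (h : direct_sum_space) : direct_sum_space :=
  exist _ _ (direct_sum_subproof a h).

Definition separating := forall a b : A, direct_sum a = direct_sum b -> a = b.

End DirectSum.

Section Spectrum.
Variable R : realType.

Definition spec (H : hilbertType R) (T : bounded_map H H) : set R[i] :=
  [set l | ~ exists S : bounded_map H H,
     forall x, S (T x - l *: x) = x /\ T (S x) - l *: S x = x].

Definition cstar_spec (A : cstarAlgType R) (a : A) : set R[i] :=
  [set l | ~ exists b : A,
     cmul b (a - l *: cunit) = cunit /\ cmul (a - l *: cunit) b = cunit].

Definition positive (A : cstarAlgType R) (a : A) :=
  star a = a /\ forall l, cstar_spec a l -> 0 <= l.

Definition is_min_spec (H : hilbertType R) (T : bounded_map H H) (m : R) :=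
  spec T m%:C /\ forall l, spec T l -> m%:C <= l.

End Spectrum.

(* Main.v *)
From HB Require Import structures.
Require Import Defs.
From mathcomp Require Import all_boot all_order all_algebra.
From mathcomp Require Import complex ring lra.
From mathcomp Require Import all_classical all_reals all_analysis.

Set Implicit Arguments.
Unset Strict Implicit.
Unset Printing Implicit Defensive.

Import Order.TTheory GRing.Theory Num.Theory.
Import numFieldNormedType.Exports.

Local Open Scope classical_set_scope.
Local Open Scope complex_scope.
Local Open Scope ring_scope.

(** Let [c] be a real number with [rnorm (s t) <= c < m] for every [s] in
    [Delta] not weakly equivalent to [pi].  A continuous function of [t] that
    vanishes up to [c] but not at [m] is killed by all those [s], yet not by
    [pi].  The only function needed is [h + |h|], with [h] a positive multiple
    of [t - c]: [exists_separating_element].  The absolute value comes from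
    square roots of elements [1 - x] with [rnorm x <= 1], obtained by a fixed
    point iteration ([cstar_sqrt_closed_ball], [cstar_abs_sqrt]); its image in a
    representation where [h] is negative is computed from uniqueness of positive
    square roots ([rep_abs_neg]).

    By Burnside's theorem for [pi] ([rank_one_in_range]), [pi] maps [A] onto all
    operators of its finite-dimensional space, so the ideal generated by this
    element contains some [p] with [pi p = 1] ([ideal_contains_unit]).  For [s]
    in [Delta], [s p = 0] when [s] is not weakly equivalent to [pi], and [s]
    has the kernel of [pi] otherwise.  As [Delta] is separating, [p] therefore
    annihilates the kernel of [pi].

    Everything else follows from the two properties [pi p = 1] and
    [p (ker pi) = 0].  They make [p] a central projection on whose corner [pi]
    is injective ([cover_eq], [cover_central]).  The ideal [ker pi^**] is
    generated by [1 - p], since for every functional [phi] of [A] the functional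
    [phi (p .)] factors through [pi] by finite dimension ([cover_support]).
    Finally an irreducible [s] with [s p != 0] has a unit vector [xi] fixed by
    the image of a minimal projection [q] of the corner, and mapping the vector
    [pi a w] to [s a xi], for [w] the unit vector fixed by [pi q], is a unitary
    equivalence ([cover_unitary]).  So [p] vanishes in all irreducible
    representations that are not unitarily equivalent to [pi], while its norm in
    [pi] is [1]. *)

(** * Limits in norm, and square roots in a C*-algebra *)

Section NormLimits.
Variables (R : realType).

Lemma rnorm_real (r : R) : 0 <= r -> rnorm (r%:C : R[i]^o) = r.
Proof. by move=> r0; rewrite /rnorm /= expr0n addr0 sqrtr_sqr ger0_norm. Qed.

Lemma rnorm_small (V : normedModType R[i]) (x : V) (c : R) :
  0 <= c -> (forall e : R, 0 < e -> rnorm x <= c * e) -> x = 0.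
Proof.
move=> c0 xe; apply/rnorm0_eq0/eqP; rewrite eq_le rnorm_ge0 andbT.
apply/ler_addgt0Pr => e e0; rewrite add0r.
have c1 : 0 < c + 1 by rewrite ltr_wpDl.
rewrite (le_trans (xe (e / (c + 1)) _)) ?divr_gt0//.
by rewrite mulrCA ler_piMr ?(ltW e0)// ler_pdivrMr// mul1r lerDl.
Qed.

Lemma ball_rnorm (V : normedModType R[i]) (e : R[i]) (x y : V) : 0 < e ->
  ball x e y = (rnorm (x - y) < complex.Re e).
Proof.
rewrite -ball_normE /= rnormE; case: e => a b.
by rewrite !ltcE /= => /andP[/eqP-> _]; rewrite eqxx.
Qed.

Lemma closed_rnorm (V : normedModType R[i]) (M : set V) :
  (forall x, (forall e : R, 0 < e -> exists2 y, M y & rnorm (x - y) < e) ->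
    M x) -> closed M.
Proof.
move=> Mlim x clx; apply: Mlim => e e0.
have e0C : (0 : R[i]) < e%:C by rewrite ltcR.
have [y [My]] := clx _ (nbhsx_ballx x e%:C e0C).
by rewrite ball_rnorm// => xy; exists y.
Qed.

Lemma rnorm_cauchy (V : completeNormedModType R[i]) (u : nat -> V) :
  (forall e : R, 0 < e -> exists N, forall n m, (N <= n)%N -> (N <= m)%N ->
    rnorm (u n - u m) < e) ->
  exists l, forall e : R, 0 < e -> exists N, forall n,
    (N <= n)%N -> rnorm (u n - l) < e.
Proof.
move=> uc; have : cvgn u.
  apply/cauchy_cvgP; apply/cauchy_ballP => e e0; near_simpl.
  have eR : 0 < complex.Re e by move: e0; rewrite ltcE => /andP[].
  have [N Ne] := uc _ eR.
  exists ([set n | (N <= n)%N], [set n | (N <= n)%N]) => /=.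
    by split; exists N.
  by move=> [n m] /= [Nn Nm]; rewrite ball_rnorm// Ne.
move=> /cvg_ex[l ul]; exists l => e e0.
have /cvg_ballP/(_ e%:C) := ul; rewrite ltcR => /(_ e0)[N _ Ne].
by exists N => n /Ne; rewrite /= ball_rnorm ?ltcR// rnormB.
Qed.

End NormLimits.

Section CStarSqrt.
Variables (R : realType) (A : cstarAlgType R).
Implicit Types b h x y : A.

(** The square root iteration [y |-> (x + y ^ 2) / 2] for the number [x = 1]:
    its increments bound those of the iteration for any [x] in the unit
    ball. *)
Fixpoint sqrt_bound (n : nat) : R :=
  if n is n'.+1 then (1 + sqrt_bound n' ^+ 2) / 2 else 0.

Lemma sqrt_bound01 n : 0 <= sqrt_bound n <= 1.
Proof.
elim: n => [|n /andP[a0 a1]] /=; first by rewrite lexx ler01.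
rewrite divr_ge0 ?addr_ge0 ?sqr_ge0//= ler_pdivrMr// mul1r.
by rewrite [leRHS]mulr2n lerD2l expr_le1.
Qed.

Lemma sqrt_bound_le m n : (m <= n)%N -> sqrt_bound m <= sqrt_bound n.
Proof.
move=> mn; apply: (@homo_leq _ sqrt_bound Order.le) => //.
  exact: le_trans.
move=> k /=; rewrite ler_pdivlMr// -subr_ge0.
suff -> : 1 + sqrt_bound k ^+ 2 - sqrt_bound k * 2 = (1 - sqrt_bound k) ^+ 2.
  exact: sqr_ge0.
by ring.
Qed.

Lemma sqrt_bound_cauchy (e : R) : 0 < e -> exists N, forall n m,
  (N <= n)%N -> (n <= m)%N -> sqrt_bound m - sqrt_bound n < e.
Proof.
move=> e0; pose S := [set sqrt_bound n | n in setT].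
have Ssup : has_sup S.
  split; first by exists (sqrt_bound 0), 0%N.
  by exists 1 => _ [n _ <-]; have /andP[] := sqrt_bound01 n.
have [_ [N _ <-] SN] := sup_adherent e0 Ssup.
exists N => n m Nn nm; rewrite ltrBlDr.
have Sm : sqrt_bound m <= sup S by apply: sup_upper_bound => //; exists m.
have aNn := sqrt_bound_le Nn.
by rewrite (le_lt_trans Sm)// -ltrBlDl (lt_le_trans SN).
Qed.

Let half : R[i] := (2^-1 : R)%:C.

Let half_norm : rnorm (half : R[i]^o) = 2^-1.
Proof. by rewrite rnorm_real. Qed.

Let half_conj : half^*%C = half.
Proof. by rewrite /half /= oppr0. Qed.

Let halfD : half + half = 1.
Proof.
by rewrite -rmorphD /= [2^-1 + _](_ : _ = 1)// [RHS]splitr !mul1r.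
Qed.

Lemma cmul_sqrB x y : cmul x x - cmul y y = cmul x (x - y) + cmul (x - y) y.
Proof. by rewrite cmulBl cmulBr addrA subrK. Qed.

(** On the closed ball the iteration is no contraction, but its terms are
    polynomials in [x] with nonnegative coefficients, so that it converges
    because it converges for the number [1]. *)
Lemma cstar_sqrt_closed_ball x : rnorm x <= 1 -> star x = x ->
  exists y, [/\ star y = y, rnorm y <= 1,
    cmul (cunit - y) (cunit - y) = cunit - x &
    forall b, cmul b x = cmul x b -> cmul b y = cmul y b].
Proof.
move=> x1 xs.
pose f y := half *: (x + cmul y y).
have fB y z : f y - f z = half *: (cmul y (y - z) + cmul (y - z) z).
  by rewrite /f -scalerBr opprD addrACA subrr add0r cmul_sqrB.
have fle y z (c e : R) : 0 <= e -> rnorm y + rnorm z <= c ->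
    rnorm (y - z) <= e -> rnorm (f y - f z) <= c / 2 * e.
  move=> e0 yzc yze; rewrite fB rnormZ half_norm ler_pdivrMl//.
  rewrite mulrA (mulrC 2) divfK// (le_trans (rnormD _ _))//.
  rewrite (le_trans (lerD (rnormM _ _) (rnormM _ _)))//.
  rewrite (mulrC (rnorm (y - z))) -mulrDl.
  by apply: ler_pM; rewrite ?addr_ge0 ?rnorm_ge0.
pose u n := iter n f 0.
have ua n : rnorm (u n) <= sqrt_bound n.
  elim: n => [|n ih]; first by rewrite rnorm0.
  rewrite /= rnormZ half_norm mulrC ler_pM2r ?invr_gt0//.
  rewrite (le_trans (rnormD _ _))// lerD// (le_trans (rnormM _ _))//.
  by rewrite expr2 ler_pM ?rnorm_ge0.
have u1 n : rnorm (u n) <= 1.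
  by rewrite (le_trans (ua n))//; have /andP[] := sqrt_bound01 n.
have uS n : rnorm (u n.+1 - u n) <= sqrt_bound n.+1 - sqrt_bound n.
  elim: n => [|n ih].
    have -> : u 0%N = 0 by []; rewrite subr0 /sqrt_bound -/sqrt_bound subr0.
    exact: (ua 1%N).
  have uE k : u k.+1 = f (u k) by [].
  rewrite (uE n.+1) {2}(uE n).
  have e0 : 0 <= sqrt_bound n.+1 - sqrt_bound n.
    by rewrite subr_ge0 sqrt_bound_le.
  rewrite (le_trans (fle _ _ _ _ e0 (lerD (ua _) (ua _)) ih))//.
  have aE k : sqrt_bound k.+1 = (1 + sqrt_bound k ^+ 2) / 2 by [].
  by rewrite (aE n.+1) {4}(aE n) le_eqVlt; apply/orP; left; apply/eqP; field.
have umn n m : (n <= m)%N -> rnorm (u m - u n) <= sqrt_bound m - sqrt_bound n.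
  move=> /subnKC <-; elim: (m - n)%N => [|k ih].
    by rewrite addn0 !subrr rnorm0.
  rewrite addnS (le_trans (rnorm_distD (u (n + k)%N) _ _))//.
  rewrite (le_trans (lerD (uS _) ih))//.
  by rewrite addrA subrK.
have [|y yl] := @rnorm_cauchy _ A u.
  move=> e /sqrt_bound_cauchy[N Ne]; exists N => n m Nn Nm.
  case/orP: (leq_total n m) => nm.
    by rewrite rnormB (le_lt_trans (umn _ _ nm))// Ne.
  by rewrite (le_lt_trans (umn _ _ nm))// Ne.
have lim0 (w : A) (c : R) : 0 <= c ->
    (forall n, rnorm w <= c * rnorm (u n - y)) -> w = 0.
  move=> c0 wu.
  apply: (@rnorm_small _ _ w c) => // e /yl[N /(_ N (leqnn N)) Ne].
  by rewrite (le_trans (wu N))// ler_wpM2l// ltW.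
have y1 : rnorm y <= 1.
  apply/ler_addgt0Pr => e /yl[N /(_ N (leqnn N)) Ne].
  by rewrite -(subrK (u N) y) addrC (le_trans (rnormD _ _))// lerD// rnormB ltW.
have yf : f y = y.
  apply/eqP; rewrite -subr_eq0; apply/eqP.
  apply: (@rnorm_small _ _ _ 2) => // e e0.
  have [N Ne] := yl _ e0.
  rewrite (le_trans (rnorm_distD (u N.+1) _ _))// mulrDl mul1r lerD//.
    rewrite -[e in leRHS]mul1r -[1 in leRHS](@divff _ 2) //.
    by apply: fle; rewrite ?(ltW e0)// ?lerD// rnormB ltW// Ne.
  by rewrite ltW// Ne.
have us n : star (u n) = u n.
  elim: n => [|n ih] /=.
    by apply/rnorm0_eq0; rewrite rnorm_star rnorm0.
  by rewrite /f starZ half_conj starD starM xs -/(u n) ih.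
have ys : star y = y.
  apply/eqP; rewrite -subr_eq0; apply/eqP/(@lim0 _ 2) => // n.
  rewrite (le_trans (rnorm_distD (u n) _ _))// mulrDl mul1r lerD//.
  by rewrite -{1}(us n) -starB rnorm_star rnormB.
exists y; split=> // [|b bx].
  rewrite cmulBl cmul1r cmulBr cmulr1 opprB.
  have -> : x = (y + y) - cmul y y.
    have <- : half *: (x + cmul y y) + half *: (x + cmul y y) = y + y.
      by rewrite -/(f y) yf.
    by rewrite -scalerDl halfD scale1r addrK.
  by rewrite opprB opprD -addrA; congr (_ + _); rewrite addrCA.
have ub n : cmul b (u n) = cmul (u n) b.
  elim: n => [|n ih] /=.
    by rewrite -(scale0r x) cmulZl cmulZr !scale0r.
  rewrite /f cmulZl cmulZr cmulDl cmulDr bx -/(u n); congr (_ *: (_ + _)).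
  by rewrite cmulA ih -cmulA ih cmulA.
apply/eqP; rewrite -subr_eq0; apply/eqP/(@lim0 _ (2 * rnorm b)).
  by rewrite mulr_ge0 ?rnorm_ge0.
move=> n.
have -> : cmul b y - cmul y b = cmul b (y - u n) - cmul (y - u n) b.
  by rewrite cmulBr cmulBl ub opprB addrA subrK.
rewrite (le_trans (rnormD _ _))// rnormN -mulrA mulrDl mul1r.
rewrite (rnormB (u n)) lerD ?rnormM// mulrC; exact: rnormM.
Qed.

(** With [c] a square root of [1 - h ^ 2], the elements [h + i c] and [h - i c]
    are unitary, hence of norm at most [1], and so is [c], whose double is up to
    a phase their difference. *)
Lemma rnorm_one_sub_sqr h : star h = h -> rnorm h < 1 ->
  rnorm (cunit - cmul h h) <= 1.
Proof.
move=> hs h1.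
have [||y [ys _ yh ycomm]] := @cstar_sqrt_closed_ball (cmul h h).
- by rewrite -{1}hs cstar_identity expr_le1 ?rnorm_ge0// ltW.
- by rewrite starM hs.
set c := cunit - y in yh.
have cs : star c = c by rewrite starB star1 ys.
have hc : cmul h c = cmul c h.
  by rewrite cmulBr cmulBl cmulr1 cmul1r ycomm// cmulA.
have isos (w : A) : cmul (star w) w = cunit -> rnorm w <= 1.
  move=> ww; have : rnorm w ^+ 2 <= 1.
    rewrite -cstar_identity ww.
    have : rnorm (cunit : A) = rnorm (cunit : A) ^+ 2.
      by rewrite -cstar_identity star1 cmul1r.
    have [->|n0] := eqVneq (rnorm (cunit : A)) 0; first by rewrite ler01.
    by rewrite expr2 -{1}(mul1r (rnorm _)) => /(mulIf n0) <-.
  by rewrite expr_le1 ?rnorm_ge0.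
have conji : ('i%C : R[i])^*%C = - 'i%C.
  by apply/eqP; rewrite eq_complex/= oppr0 !eqxx.
have ii : ('i%C : R[i]) * 'i%C = -1 by rewrite -expr2 sqr_i.
have w1 (e : R[i]) : e^*%C = - e -> e * e = -1 -> rnorm (h + e *: c) <= 1.
  move=> eE ee; apply: isos; rewrite starD starZ hs cs eE.
  rewrite cmulDl !cmulDr !cmulZl !cmulZr scalerA hc.
  rewrite mulNr ee opprK scale1r scaleNr addrA addrK yh.
  by rewrite addrC subrK.
have cE : ('i%C + 'i%C : R[i]) *: c = (h + 'i%C *: c) - (h + (- 'i%C) *: c).
  by rewrite opprD addrACA subrr add0r scaleNr opprK -scalerDl.
have c1 : rnorm c <= 1.
  have n2 : rnorm ('i%C + 'i%C : R[i]^o) = 2.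
    by rewrite /rnorm /= addr0 expr0n add0r sqrtr_sqr ger0_norm ?addr_ge0.
  rewrite -(ler_pM2l (ltr0n _ 2)) -{1}n2 -rnormZ cE mulr1.
  rewrite (le_trans (rnormD _ _))// mulr2n lerD ?rnormN// w1//.
    by rewrite -conji conjcK conji opprK.
  by rewrite mulrNN.
rewrite -yh (le_trans (rnormM _ _))// -[leRHS]mulr1 ler_pM ?rnorm_ge0//.
Qed.

(** The absolute value of [h] is a square root [1 - y] of
    [h ^ 2 = 1 - (1 - h ^ 2)].  Extracting a further square root presents it as
    the square of [d], which is the form in which its positivity is used. *)
Lemma cstar_abs_sqrt h : star h = h -> rnorm h < 1 ->
  exists d, [/\ star d = d, cmul h (cmul d d) = cmul (cmul d d) h &
    cmul (cmul d d) (cmul d d) = cmul h h].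
Proof.
move=> hs h1.
have [||y [ys y1 yh ycomm]] := @cstar_sqrt_closed_ball (cunit - cmul h h).
- exact: rnorm_one_sub_sqr.
- by rewrite starB star1 starM hs.
have [//|//|d [ds _ dy _]] := @cstar_sqrt_closed_ball y.
exists (cunit - d); rewrite starB star1 ds dy yh opprB addrCA subrr addr0.
split=> //; rewrite cmulBr cmulBl cmulr1 cmul1r ycomm//.
by rewrite cmulBr cmulBl cmulr1 cmul1r cmulA.
Qed.

End CStarSqrt.

(** * Orthonormal families in a Hilbert space *)

Section InnerProduct.
Variables (R : realType) (H : hilbertType R).
Implicit Types (x y z : H) (l : R[i]).

Lemma innerDl x y z : inner (x + y) z = inner x z + inner y z.
Proof. exact: linearDl. Qed.

Lemma innerBl x y z : inner (x - y) z = inner x z - inner y z.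
Proof. exact: linearBl. Qed.

Lemma innerBr x y z : inner x (y - z) = inner x y - inner x z.
Proof. exact: linearBr. Qed.

Lemma innerZl l x y : inner (l *: x) y = l * inner x y.
Proof. by rewrite linearZl_LR. Qed.

Lemma innerZr l x y : inner x (l *: y) = l^*%C * inner x y.
Proof. by rewrite linearZr_LR. Qed.

Lemma inner0l x : inner 0 x = 0.
Proof. exact: linear0l. Qed.

Lemma inner0r x : inner x 0 = 0.
Proof. exact: linear0r. Qed.

Lemma inner_suml n (F : 'I_n -> H) x :
  inner (\sum_i F i) x = \sum_i inner (F i) x.
Proof. exact: linear_sumlz. Qed.

Lemma innerC x y : inner x y = (inner y x)^*%C.
Proof.
by rewrite (@hermC _ false (@conjc R) _ (@inner _ H)) expr0 mul1r.
Qed.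

Lemma inner_ge0 x : 0 <= inner x x.
Proof. by rewrite inner_rnorm ler0c sqr_ge0. Qed.

Lemma inner_eq0 x : inner x x = 0 -> x = 0.
Proof.
rewrite inner_rnorm => /complexI /eqP; rewrite sqrf_eq0 => /eqP.
exact: rnorm0_eq0.
Qed.

Lemma inner_ext x y : (forall z, inner x z = inner y z) -> x = y.
Proof.
move=> xy; apply/eqP; rewrite -subr_eq0; apply/eqP/inner_eq0.
by rewrite innerBl xy subrr.
Qed.

Lemma inner_le x y : rnorm (inner x y : R[i]^o) <= rnorm x * rnorm y.
Proof.
have [y0|y0] := eqVneq (rnorm y) 0.
  by rewrite (rnorm0_eq0 y0) inner0r !rnorm0 mulr0.
have yy0 : inner y y != 0.
  by apply: contra_neq y0 => /inner_eq0 ->; rewrite rnorm0.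
have := inner_ge0 (inner y y *: x - inner x y *: y).
rewrite innerBl !innerBr !innerZl !innerZr.
have -> : (inner y y)^*%C = inner y y by rewrite -innerC.
rewrite (innerC y x).
rewrite [leRHS](_ : _ = inner y y *
  (inner x x * inner y y - inner x y * (inner x y)^*%C)); last by ring.
rewrite pmulr_rge0 ?lt_def ?yy0 ?inner_ge0// subr_ge0.
have -> : inner x y * (inner x y)^*%C = (rnorm (inner x y : R[i]^o) ^+ 2)%:C.
  by rewrite rmorphXn /= -rnormE -sqr_normc.
rewrite !inner_rnorm -rmorphM lecR -exprMn.
by rewrite ler_sqr ?nnegrE ?mulr_ge0 ?rnorm_ge0.
Qed.

Lemma inner_normalize x : x != 0 ->
  inner ((rnorm x)^-1%:C *: x) ((rnorm x)^-1%:C *: x) = 1.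
Proof.
move=> x0; have n0 : rnorm x != 0 by apply: contra_neq x0; exact: rnorm0_eq0.
have kc : ((rnorm x)^-1%:C)^*%C = (rnorm x)^-1%:C by rewrite /= oppr0.
rewrite innerZl innerZr kc inner_rnorm -!rmorphM.
by rewrite (_ : _^-1 * (_^-1 * _) = 1)//; field.
Qed.

Lemma rnorm_inner1 x : inner x x = 1 -> rnorm x = 1.
Proof.
rewrite inner_rnorm => /complexI/eqP; rewrite sqrf_eq1 => /orP[/eqP//|/eqP x1].
by have := rnorm_ge0 x; rewrite x1 oppr_ge0 ler10.
Qed.

End InnerProduct.

Section Orthonormal.
Variables (R : realType) (H : hilbertType R).
Implicit Types (x y z : H) (l : R[i]).

Definition orthonormal n (f : 'I_n -> H) :=
  forall i j, inner (f i) (f j) = (i == j)%:R.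

Definition expansion n (f : 'I_n -> H) x := \sum_i inner x (f i) *: f i.

Definition subspace (M : set H) :=
  M 0 /\ forall l x y, M x -> M y -> M (l *: x + y).

Lemma subspace_sum (M : set H) n (F : 'I_n -> H) :
  subspace M -> (forall i, M (F i)) -> M (\sum_i F i).
Proof.
move=> [M0 ML] MF; elim/big_ind: _ => // x y Mx My.
by rewrite -(scale1r x); exact: ML.
Qed.

Lemma subspaceZ (M : set H) l x : subspace M -> M x -> M (l *: x).
Proof. by move=> [M0 ML] Mx; rewrite -(addr0 (l *: x)); exact: ML. Qed.

Lemma subspaceB (M : set H) x y : subspace M -> M x -> M y -> M (x - y).
Proof.
by move=> [M0 ML] Mx My; rewrite addrC -scaleN1r; exact: ML.
Qed.

Lemma inner_expansion n (f : 'I_n -> H) x i : orthonormal f ->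
  inner (expansion f x) (f i) = inner x (f i).
Proof.
move=> fo; rewrite inner_suml (bigD1 i)//= innerZl fo eqxx mulr1.
by rewrite big1 ?addr0// => j /negbTE ji; rewrite innerZl fo ji mulr0.
Qed.

Lemma expansion_in (M : set H) n (f : 'I_n -> H) x :
  subspace M -> (forall i, M (f i)) -> M (expansion f x).
Proof.
by move=> Ms Mf; apply: subspace_sum => // i; exact: subspaceZ.
Qed.

(** The Gram-Schmidt step, inside a subspace. *)
Lemma orthonormal_extend (M : set H) n (f : 'I_n -> H) x :
  subspace M -> orthonormal f -> (forall i, M (f i)) ->
  M x -> x != expansion f x ->
  exists f' : 'I_n.+1 -> H, orthonormal f' /\ forall i, M (f' i).
Proof.
move=> Ms fo Mf Mx; rewrite -subr_eq0; set r := x - _ => r0.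
have Mr : M r by apply: subspaceB => //; exact: expansion_in.
have rf i : inner r (f i) = 0 by rewrite innerBl inner_expansion// subrr.
have fr i : inner (f i) r = 0 by rewrite innerC rf conjc0.
pose g := (rnorm r)^-1%:C *: r.
exists (fun i => if unlift ord_max i is Some j then f j else g).
split=> [i j|i]; last by case: unliftP => // _; exact: subspaceZ.
case: unliftP => [i' ->|->]; case: unliftP => [j' ->|->].
- by rewrite fo (inj_eq (lift_inj)).
- by rewrite innerZr fr mulr0 eq_sym (negbTE (neq_lift _ _)).
- by rewrite innerZl rf mulr0 (negbTE (neq_lift _ _)).
- by rewrite inner_normalize// eqxx.
Qed.

Definition spanning n (e : 'I_n -> H) :=
  forall x, exists c : 'I_n -> R[i], x = \sum_(i < n) c i *: e i.

(** The Gram matrix of [f] is the identity and factors through dimension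
    [n]. *)
Lemma orthonormal_size n (e : 'I_n -> H) k (f : 'I_k -> H) :
  spanning e -> orthonormal f -> (k <= n)%N.
Proof.
move=> esp fo; have [c fE] := choice (fun i => esp (f i)).
apply: (@mulmx1_min _ _ _ (\matrix_(i, j) c i j)
  (\matrix_(j, l) inner (e j) (f l))).
apply/matrixP => i l; rewrite !mxE -fo (fE i) inner_suml.
by apply: eq_bigr => j _; rewrite !mxE innerZl.
Qed.

(** An orthonormal family of maximal size; spanning sets bound the size. *)
Lemma orthonormal_basis n (e : 'I_n -> H) (M : set H) :
  spanning e -> subspace M ->
  exists k (f : 'I_k -> H), [/\ orthonormal f, forall i, M (f i) &
    forall x, M x -> x = expansion f x].
Proof.
move=> esp Ms.
pose P k := `[< exists f : 'I_k -> H, orthonormal f /\ forall i, M (f i) >].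
have P0 : exists k, P k.
  by exists 0%N; apply/asboolP; exists (fun=> 0); split=> [[]|[]].
have Pn k : P k -> (k <= n)%N.
  by move=> /asboolP[f [fo _]]; exact: orthonormal_size esp fo.
have [k /asboolP[f [fo Mf]] kmax] := ex_maxnP P0 Pn.
exists k, f; split=> // x Mx; apply/eqP; apply/negPn/negP => xf.
suff /kmax : P k.+1 by rewrite ltnn.
by apply/asboolP; exact: orthonormal_extend Mx xf.
Qed.

Lemma expansion_le n (f : 'I_n -> H) x :
  orthonormal f -> rnorm (expansion f x) <= n%:R * rnorm x.
Proof.
move=> fo.
have f1 i : rnorm (f i) = 1 by apply: rnorm_inner1; rewrite fo eqxx.
rewrite /expansion mulr_natl -[n in leRHS]card_ord -sumr_const.
elim/big_ind2: _ => [|a b c d ab cd|i _]; first by rewrite rnorm0.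
  by rewrite (le_trans (rnormD _ _))// lerD.
by rewrite rnormZ f1 mulr1 (le_trans (inner_le _ _))// f1 mulr1.
Qed.

Lemma expansionB n (f : 'I_n -> H) x y :
  expansion f (x - y) = expansion f x - expansion f y.
Proof.
by rewrite /expansion -sumrB; apply: eq_bigr => i _; rewrite innerBl scalerBl.
Qed.

Lemma closed_span n (f : 'I_n -> H) :
  orthonormal f -> closed [set x | x = expansion f x].
Proof.
move=> fo; apply: closed_rnorm => x xlim /=.
apply/eqP; rewrite -subr_eq0; apply/eqP; apply: (@rnorm_small _ _ _ (1 + n%:R)).
  by rewrite addr_ge0.
move=> e /xlim[y /= yf xy].
have -> : x - expansion f x = (x - y) - expansion f (x - y).
  by rewrite expansionB -yf opprB addrA subrK.
rewrite (le_trans (rnormD _ _))// rnormN mulrDl mul1r lerD ?(ltW xy)//.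
by rewrite (le_trans (expansion_le _ fo))// ler_wpM2l// ltW.
Qed.

(** A subspace of a finite-dimensional space is the fixed set of the expansion
    along its basis, which is continuous. *)
Lemma subspace_closed n (e : 'I_n -> H) (M : set H) :
  spanning e -> subspace M -> closed M.
Proof.
move=> esp Ms; have [k [f [fo Mf fM]]] := orthonormal_basis esp Ms.
suff -> : M = [set x | x = expansion f x] by exact: closed_span.
apply/seteqP; split=> [x Mx|x /= ->]; first exact: fM.
exact: expansion_in.
Qed.

(** The eigenvalues of the matrix of [T] on an orthonormal basis of [M]. *)
Lemma eigenvector_ex n (e : 'I_n -> H) (M : set H) (T : {linear H -> H}) z :
  spanning e -> subspace M -> (forall x, M x -> M (T x)) -> M z -> z != 0 ->
  exists l x, [/\ M x, x != 0 & T x = l *: x].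
Proof.
move=> esp Ms MT Mz z0; have [k [f [fo Mf fM]]] := orthonormal_basis esp Ms.
have k0 : (0 < k)%N.
  case: k f fo Mf fM => // f _ _ fM; move: z0; rewrite (fM _ Mz).
  by rewrite /expansion big_ord0 eqxx.
pose C := \matrix_(i < k, j < k) inner (T (f i)) (f j).
have [l /eigenvalueP[w wC w0]] := eigenvalue_closed C k0.
exists l, (\sum_i w 0 i *: f i); split.
- by apply: subspace_sum => // i; exact: subspaceZ.
- apply: contra w0 => /eqP w0; apply/eqP/rowP => i; rewrite mxE.
  have : inner (\sum_i w 0 i *: f i) (f i) = 0 by rewrite w0 inner0l.
  rewrite inner_suml (bigD1 i)//= innerZl fo eqxx mulr1 big1 ?addr0//.
  by move=> j /negbTE ji; rewrite innerZl fo ji mulr0.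
- rewrite linear_sum scaler_sumr.
  under eq_bigr => i _ do rewrite linearZ /= (fM _ (MT _ (Mf i))) scaler_sumr.
  rewrite exchange_big; apply: eq_bigr => j _ /=; rewrite scalerA.
  have := congr1 (fun m : 'rV_k => m 0 j) wC; rewrite !mxE => <-.
  rewrite scaler_suml; apply: eq_bigr => i _.
  by rewrite scalerA mxE.
Qed.

End Orthonormal.

(** * Irreducible representations, and Burnside's theorem *)

Section RepBasics.
Variables (R : realType) (A : cstarAlgType R) (s : starRep A).
Implicit Types (a b : A) (x y z : rep_space s) (l : R[i]).

Lemma repD a b x : s (a + b) x = s a x + s b x.
Proof. by rewrite linearD. Qed.

Lemma repB a b x : s (a - b) x = s a x - s b x.
Proof. by rewrite linearB. Qed.

Lemma repZ l a x : s (l *: a) x = l *: s a x.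
Proof. by rewrite linearZ. Qed.

Lemma rep0 x : s 0 x = 0.
Proof. by rewrite linear0. Qed.

Lemma rep_sum (I : finType) (F : I -> A) x :
  s (\sum_i F i) x = \sum_i s (F i) x.
Proof.
elim/big_rec2: _ => [|i y b _ <-]; [exact: rep0|exact: repD].
Qed.

Lemma rep_adj a x y : inner (s a x) y = inner x (s (star a) y).
Proof. by rewrite -rep_star starK. Qed.

Lemma rep_eq0 a : s a = 0 <-> forall x, s a x = 0.
Proof.
by split=> [->//|a0]; apply/bounded_mapP => x; rewrite a0.
Qed.

Lemma rep_neq0 a : s a != 0 <-> exists x, s a x != 0.
Proof.
split=> [|[x]]; last by apply: contra => /eqP/rep_eq0 ->.
move=> a0; apply: contrapT => ax; move/eqP: a0; apply; apply/rep_eq0 => x.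
by apply/eqP/negPn/negP => ax0; apply: ax; exists x.
Qed.

(** The vectors fixed by the image of the unit form a closed invariant subspace
    containing the range of every [s a]. *)
Lemma rep_unit x : irreducible s -> s cunit x = x.
Proof.
move=> [[a a0] sirr].
have [||l y z|||] := sirr [set x | s cunit x = x].
- apply: closed_rnorm => y ylim /=; apply/eqP; rewrite -subr_eq0; apply/eqP.
  apply: (@rnorm_small _ _ _ 2) => // e /ylim[z /= zE yz].
  have -> : s cunit y - y = s cunit (y - z) - (y - z).
    by rewrite linearB /= zE opprB addrA subrK.
  rewrite (le_trans (rnormD _ _))// rnormN mulrDl mul1r lerD ?(ltW yz)//.
  by rewrite (le_trans (rep_unit_le _))// ltW.
- exact: linear0.
- by move=> /= y1 z1; rewrite linearP /= y1 z1.
- by move=> b y /= _; rewrite -repM cmul1r.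
- move=> M0; have [y] := (rep_neq0 a).1 a0.
  have : [set x | s cunit x = x] (s a y) by rewrite /= -repM cmul1r.
  by rewrite M0 => /= ->; rewrite eqxx.
- by move=> MT; have : [set x | s cunit x = x] x by rewrite MT.
Qed.

End RepBasics.

Section Burnside.
Variables (R : realType) (A : cstarAlgType R) (s : starRep A).
Hypotheses (s_irr : irreducible s) (s_fin : finite_dimensional s).
Implicit Types (a b : A) (x y z : rep_space s) (l : R[i]).

Lemma rep_transitive x y : x != 0 -> exists a, s a x = y.
Proof.
have [n [e esp]] := s_fin.
move=> x0; pose M := [set y | exists a, s a x = y].
have Ms : subspace M.
  split; first by exists 0; rewrite rep0.
  by move=> l _ _ [a <-] [b <-]; exists (l *: a + b); rewrite repD repZ.
have [_ sirr] := s_irr; have [|||||] := sirr M.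
- exact: subspace_closed Ms.
- by have [] := Ms.
- by have [] := Ms.
- by move=> a _ [b <-]; exists (cmul a b); rewrite repM.
- move=> M0; have : M x by exists cunit; exact: rep_unit.
  by rewrite M0 => /= xE; rewrite xE eqxx in x0.
- by move=> MT; have : M y by rewrite MT.
Qed.

(** Take [a] outside the kernel of [s] with [ker (s a)] as large as possible.
    For a given vector [x = s b u] and an eigenvector [s a z], of eigenvalue
    [l], of [s (a b)] on the range of [s a], the element [a b a - l a] kills
    [z] on top of [ker (s a)], so [s] kills it: the range of [s a] is a
    line. *)
Let rank_le1 : exists a (u : rep_space s), [/\ u != 0, exists x, s a x = u &
  forall x, exists l, s a x = l *: u].
Proof.
have [n [e esp]] := s_fin.
pose P k := `[< exists2 a, (exists x, s a x != 0) &
  exists f : 'I_k -> rep_space s, orthonormal f /\ forall i, s a (f i) = 0 >].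
have P0 : exists k, P k.
  exists 0%N; apply/asboolP; have [[a /rep_neq0 a0] _] := s_irr; exists a => //.
  by exists (fun=> 0); split=> [[]|[]].
have Pn k : P k -> (k <= n)%N.
  by move=> /asboolP[a _ [f [fo _]]]; exact: orthonormal_size esp fo.
have [k /asboolP[a [x0 ax0] [f [fo af]]] kmax] := ex_maxnP P0 Pn.
exists a, (s a x0); split=> // [|x]; first by exists x0.
have [b bx] := rep_transitive x ax0.
pose M := [set y | exists z, s a z = y].
have Ms : subspace M.
  split; first by exists 0; rewrite linear0.
  by move=> l _ _ [y <-] [z <-]; exists (l *: y + z); rewrite linearP.
have [||//|l [_ [[z <-] az0 abl]]] :=
    @eigenvector_ex _ _ n e M (s (cmul a b)) (s a x0) esp Ms.
- by move=> _ [y <-]; exists (s b (s a y)); rewrite /= repM.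
- by exists x0.
exists l; pose c := cmul (cmul a b) a - l *: a.
have cE y : s c y = s (cmul a b) (s a y) - l *: s a y.
  by rewrite repB repZ repM.
suff c0 : forall y, s c y = 0.
  by apply/eqP; rewrite -subr_eq0 -bx -repM -cE c0.
apply: contrapT => /existsNP[y /eqP cy].
suff /kmax : P k.+1 by rewrite ltnn.
apply/asboolP; exists c; first by exists y.
apply: (@orthonormal_extend _ _ [set y | s c y = 0] _ f z) => //=.
- split=> [|l' v w /= v0 w0]; first exact: linear0.
  by rewrite linearP /= v0 w0 scaler0 addr0.
- by move=> i; rewrite cE af linear0 scaler0 subrr.
- by rewrite cE abl subrr.
- apply: contra az0 => /eqP ->; rewrite linear_sum big1// => i _.
  by rewrite linearZ /= af scaler0.
Qed.

(** Transitivity moves the range of one rank one operator to any line, and, by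
    adjunction, its kernel to any hyperplane. *)
Lemma rank_one_in_range y z : exists a, forall x, s a x = inner x z *: y.
Proof.
have [a [u [u0 [x0 ax0] aE]]] := rank_le1.
have uu0 : inner u u != 0 by apply: contra_neq u0; exact: inner_eq0.
pose v := ((inner u u)^-1)^*%C *: s (star a) u.
have av x : s a x = inner x v *: u.
  have [l al] := aE x; rewrite al innerZr conjcK -rep_adj al innerZl.
  by rewrite mulrC mulfK.
have v0 : v != 0.
  by apply: contra_neq u0 => v0; rewrite -ax0 av v0 inner0r scale0r.
have [b bu] := rep_transitive y u0; have [c cv] := rep_transitive z v0.
exists (cmul b (cmul a (star c))) => x.
by rewrite !repM av linearZ /= bu rep_star cv.
Qed.

(** [s(A)] being the algebra of all operators, the ideal generated by an element
    outside the kernel contains a preimage of the identity. *)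
Lemma ideal_contains_unit b : s b != 0 ->
  exists n (l r : 'I_n -> A),
    forall x, s (\sum_i cmul (l i) (cmul b (r i))) x = x.
Proof.
have [m [e esp]] := s_fin.
have [|n [f [_ _ fE]]] := @orthonormal_basis _ _ m e setT esp; first by [].
move=> /rep_neq0[z]; set w := s b z => w0.
have ww0 : inner w w != 0 by apply: contra_neq w0; exact: inner_eq0.
have [r rE] := choice (fun i => rank_one_in_range z (f i)).
have [l lE] := choice (fun i => rank_one_in_range ((inner w w)^-1 *: f i) w).
exists n, l, r => x; rewrite rep_sum [RHS](fE x)//; apply: eq_bigr => i _.
rewrite !repM rE linearZ /= -/w linearZ /= lE.
by rewrite (scalerA (inner w w)) mulfV// scale1r.
Qed.

End Burnside.

(** * Lifting the unit of a representation to a central projection *)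

Section CentralCover.
Variables (R : realType) (A : cstarAlgType R) (pi : starRep A) (p : A).
Hypotheses (pi_irr : irreducible pi) (pi_fin : finite_dimensional pi).
Hypothesis p1 : forall x, pi p x = x.
Hypothesis pker : forall a, (forall x, pi a x = 0) -> cmul p a = 0.
Implicit Types (a b : A) (x y z : rep_space pi) (l : R[i]).

(** Multiplication by [p] factors through [pi]: the identities on [p] below are
    checked on operators. *)
Lemma cover_eq a b : (forall x, pi a x = pi b x) -> cmul p a = cmul p b.
Proof.
move=> ab; apply/eqP; rewrite -subr_eq0 -cmulBr; apply/eqP/pker => x.
by rewrite repB ab subrr.
Qed.

Lemma cover_star : star p = p.
Proof.
have pE : cmul p (star p) = p.
  rewrite -[RHS]cmulr1; apply: cover_eq => x; apply: inner_ext => z.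
  by rewrite rep_star p1 rep_unit.
by rewrite -pE starM starK.
Qed.

Lemma cover_idem : cmul p p = p.
Proof.
by rewrite -[RHS]cmulr1; apply: cover_eq => x; rewrite p1 rep_unit.
Qed.

Lemma cover_central a : cmul p a = cmul a p.
Proof.
have pap b : cmul p (cmul b p) = cmul p b.
  by apply: cover_eq => x; rewrite repM p1.
have := congr1 star (pap (star a)).
by rewrite !starM !starK cover_star => <-; rewrite -cmulA pap.
Qed.

(** On an orthonormal basis [f], with [pi (a ij)] the matrix units, the
    functional [psi T = \sum_ij (T_ij) phi (p (a ij))] satisfies
    [psi (pi b) = phi (p b)]; being a pullback along [pi], it is killed by every
    [G] in the kernel of [pi^**]. *)
Lemma cover_support : is_support_projection pi (bidual_embedding p).
Proof.
have pC := cover_central; have pp := cover_idem; have ps := cover_star.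
pose e := cunit - p.
have ee : cmul e e = e.
  by rewrite cmulBl cmulBr cmulr1 cmul1r cmulBr cmulr1 pp subrr subr0.
have es : star e = e by rewrite starB star1 ps.
have eC a : cmul e a = cmul a e by rewrite cmulBl cmulBr cmul1r cmulr1 pC.
exists (bidual_embedding e); split.
- split.
  + by apply/bounded_mapP => phi /=; rewrite ee.
  + by apply/bounded_mapP => phi /=; rewrite es conjcK.
  + move=> G; apply/bounded_mapP => phi /=; congr (G _).
    by apply/bounded_mapP => a /=; rewrite eC.
- apply/seteqP; split=> [_ [G _ <-]|G /= G0].
    apply/bounded_mapP => psi /=.
    rewrite [X in G X](_ : _ = 0) ?linear0//; apply/bounded_mapP => a /=.
    rewrite [X in psi X](_ : _ = 0) ?linear0//; apply/bounded_mapP => x /=.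
    by rewrite repM repB p1 rep_unit// subrr.
  exists G => //; apply/bounded_mapP => phi /=.
  have [m [v vsp]] := pi_fin.
  have [|n [f [fo _ fE]]] := @orthonormal_basis _ _ m v setT vsp; first by [].
  have [a aE] := choice (fun ij : 'I_n * 'I_n =>
    rank_one_in_range pi_irr pi_fin (f ij.1) (f ij.2)).
  pose psi (T : bounded_map (rep_space pi) (rep_space pi)) : R[i]^o :=
    \sum_ij inner (T (f ij.2)) (f ij.1) * phi (cmul p (a ij)).
  have psiL : linear psi.
    move=> l S T; rewrite /psi scaler_sumr -big_split; apply: eq_bigr => ij _.
    rewrite [(l *: S + T) _]/(l *: S (f ij.2) + T (f ij.2)).
    by rewrite innerDl innerZl mulrDl -mulrA.
  have f1 i : rnorm (f i) = 1 by apply: rnorm_inner1; rewrite fo eqxx.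
  have psile T : rnorm (psi T) <=
      (\sum_ij rnorm (phi (cmul p (a ij)) : R[i]^o)) * rnorm T.
    rewrite mulr_suml /psi.
    elim/big_ind2: _ => [|b c d k bc dk|ij _]; first by rewrite rnorm0.
      by rewrite (le_trans (rnormD _ _))// lerD.
    rewrite -[_ * phi _]/(_ *: (phi _ : R[i]^o)) rnormZ mulrC.
    rewrite ler_wpM2l ?rnorm_ge0//.
    rewrite (le_trans (inner_le _ _))// f1 mulr1.
    by rewrite (le_trans (rnorm_bound _ _))// f1 mulr1.
  have phiE : dual_shift phi e =
      phi - transpose (rep_map pi) (mk_bounded psiL psile).
    apply/bounded_mapP => b.
    rewrite [RHS]/(phi b - psi (pi b)) /= cmulBl cmul1r linearB; congr (_ - _).
    pose S := \sum_ij inner (pi b (f ij.2)) (f ij.1) *: a ij.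
    have -> : cmul p b = cmul p S.
      apply: cover_eq => x; rewrite {1}(fE x)// linear_sum rep_sum.
      under eq_bigr => j _ do
        rewrite linearZ /= (fE (pi b (f j)))// scaler_sumr.
      rewrite exchange_big pair_bigA; apply: eq_bigr => ij _ /=.
      by rewrite repZ aE !scalerA mulrC.
    transitivity (dual_shift phi p S); first by [].
    rewrite linear_sum; apply: eq_bigr => ij _.
    by rewrite linearZ.
  rewrite phiE linearB.
  have /(_ (mk_bounded psiL psile)) := (bounded_mapP _ _).2 G0.
  rewrite /= => ->.
  by rewrite subr0.
- apply/bounded_mapP => phi; rewrite [RHS]/(phi cunit - phi (cunit - p)).
  by rewrite linearB; exact: esym (subKr (phi cunit : R[i]) (phi p)).
Qed.


Lemma cover_inj a b : cmul p a = a -> cmul p b = b ->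
  (forall x, pi a x = pi b x) -> a = b.
Proof. by move=> pa pb /cover_eq; rewrite pa pb. Qed.

(** [g x] is the element of the corner of [p] that [pi] maps to the rank one
    operator [<., w> x].  If [s] vanished at the minimal projection [q = g w] it
    would vanish on the ideal generated by [q], which contains [p].  As
    [(g y)^* (g x) = <x, y> q], the map [x |-> s (g x) xi] is isometric for
    every unit vector [xi] fixed by [s q]. *)
Lemma cover_unitary (s : starRep A) :
  irreducible s -> s p != 0 -> unitarily_equivalent s pi.
Proof.
move=> s_irr sp.
have pC := cover_central; have pp := cover_idem.
have [m [v vsp]] := pi_fin.
have [|n [f [fo _ fE]]] := @orthonormal_basis _ _ m v setT vsp; first by [].
have [i0] : exists i : 'I_n, True.
  case: n f fo fE => [|n] f fo fE; last by exists ord0.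
  have [[a /rep_neq0[x ax]] _] := pi_irr; move: ax.
  by rewrite (fE (pi a x))// /expansion big_ord0 eqxx.
move=> _; pose w := f i0.
have ww : inner w w = 1 by rewrite fo eqxx.
have [g0 g0E] := choice (fun x => rank_one_in_range pi_irr pi_fin x w).
pose g x := cmul p (g0 x).
have gE x y : pi (g x) y = inner y w *: x by rewrite repM p1 g0E.
have pg x : cmul p (g x) = g x by rewrite cmulA pp.
have pag a x : cmul p (cmul a (g x)) = cmul a (g x).
  by rewrite cmulA pC -cmulA pg.
have gL l x y : g (l *: x + y) = l *: g x + g y.
  apply: cover_inj; rewrite ?pg//; first by rewrite cmulDr cmulZr !pg.
  by move=> z; rewrite repD repZ !gE scalerDr !scalerA mulrC.
have gpi a x : g (pi a x) = cmul a (g x).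
  apply: cover_inj; rewrite ?pg ?pag// => z.
  by rewrite repM !gE linearZ.
pose q := g w.
have piq : pi q != 0.
  apply/rep_neq0; exists w; rewrite gE ww scale1r.
  by apply: contra_eqN ww => /eqP ->; rewrite inner0l eq_sym oner_eq0.
have gg x y : cmul (star (g y)) (g x) = inner x y *: q.
  apply: cover_inj; rewrite ?pag// ?cmulZr ?pg// => z; apply: inner_ext => t.
  rewrite repM rep_star repZ !gE !innerZl !innerZr (innerC w t).
  by ring.
have qq : cmul q q = q.
  apply: cover_inj; rewrite ?pag ?pg// => z.
  by rewrite repM !gE innerZl ww mulr1.
have [xi [xi1 sqxi]] : exists xi, inner xi xi = 1 /\ s q xi = xi.
  have /rep_neq0[y0 y00] : s q != 0.
    apply: contra sp => /eqP/rep_eq0 q0; apply/eqP/rep_eq0 => y.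
    have [k [l [r lr]]] := ideal_contains_unit pi_irr pi_fin piq.
    rewrite -pp (@cover_eq p (\sum_i cmul (l i) (cmul q (r i)))); last first.
      by move=> x; rewrite lr p1.
    rewrite repM rep_sum big1 ?linear0// => i _.
    by rewrite repM (repM q) q0 linear0.
  set y1 := s q y0 in y00.
  exists ((rnorm y1)^-1%:C *: y1); split; first exact: inner_normalize.
  by rewrite linearZ /= -repM qq.
pose V x := s (g x) xi.
have VL : linear V by move=> l x y; rewrite /V gL repD repZ.
pose Vl : {linear rep_space pi -> rep_space s} :=
  HB.pack V (GRing.isLinear.Build _ _ _ _ V VL).
have Vsum (c : 'I_n -> R[i]) : V (\sum_i c i *: f i) = \sum_i c i *: V (f i).
  rewrite -[V]/(Vl : _ -> _) linear_sum; apply: eq_bigr => i _.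
  by rewrite linearZ.
have Viso x y : inner (V x) (V y) = inner x y.
  by rewrite -rep_star -repM gg repZ sqxi innerZl xi1 mulr1.
have Vpi a x : V (pi a x) = s a (V x) by rewrite /V gpi repM.
pose F i := V (f i).
have Fo : orthonormal F by move=> i j; rewrite Viso fo.
have VF x : V x = expansion F (V x).
  rewrite [in LHS](fE x)// /expansion Vsum; apply: eq_bigr => i _.
  by rewrite Viso.
(* The adjoint of [V], an explicit formula for its inverse. *)
pose U (y : rep_space s) := \sum_i inner y (F i) *: f i.
have UL : linear U.
  move=> l x y; rewrite /U scaler_sumr -big_split; apply: eq_bigr => i _.
  by rewrite innerDl innerZl scalerDl scalerA.
pose Ul : {linear rep_space s -> rep_space pi} :=
  HB.pack U (GRing.isLinear.Build _ _ _ _ U UL).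
have UV x : U (V x) = x.
  by rewrite [RHS](fE x)//; apply: eq_bigr => i _; rewrite Viso.
have VU (y : rep_space s) : V (U y) = y.
  rewrite Vsum; have [_ sirr] := s_irr.
  have [|||||] := sirr [set y | y = expansion F y].
  - exact: closed_span.
  - by rewrite /= -[0](linear0 Vl); exact: VF.
  - move=> l a b /= aE bE; have -> : l *: a + b = V (l *: U a + U b).
      by rewrite VL !Vsum -/(expansion F a) -/(expansion F b) -aE -bE.
    exact: VF.
  - move=> a b /= bE; have -> : s a b = V (pi a (U b)).
      by rewrite Vpi Vsum -/(expansion F b) -bE.
    exact: VF.
  - move=> M0; have : [set y | y = expansion F y] xi.
      by rewrite /= -sqxi; exact: VF.
    by rewrite M0 /= => xi0; move/eqP: xi1; rewrite xi0 inner0l eq_sym oner_eq0.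
  - by move=> MT; have : [set y | y = expansion F y] y by rewrite MT.
exists Ul; split.
- by exists V.
- by move=> x y; rewrite -Viso !VU.
- by move=> a y; rewrite -[in LHS](VU y) -Vpi; exact: UV.
Qed.

End CentralCover.

(** * Separating elements, and the peak *)

Section Separation.
Variables (R : realType) (A : cstarAlgType R).
Implicit Types (s pi : starRep A) (a b d h t : A).

(** Write [z] for the square of [d] and [y] for a vector in the range of
    [s (z + h)].  As [(z - h) (z + h) = 0], [s z y = s h y], and positivity of
    [s z] and of [- s h] forces both to be [0] at [y]. *)
Lemma rep_abs_neg s d h : star d = d -> star h = h ->
  cmul h (cmul d d) = cmul (cmul d d) h ->
  cmul (cmul d d) (cmul d d) = cmul h h ->
  (forall x, inner (s h x) x <= 0) -> s (cmul d d + h) = 0.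
Proof.
move=> ds hs hd dh hle; apply/rep_eq0 => x; set y := s _ x.
have zy : s (cmul d d) y = s h y.
  apply/eqP; rewrite -subr_eq0 -repB -repM cmulDr !cmulBl dh hd.
  by rewrite addrA subrK subrr rep0.
have dy : s d y = 0.
  apply/inner_eq0/eqP; rewrite eq_le inner_ge0 andbT.
  by rewrite -rep_star ds -repM zy hle.
have y0 : s (cmul d d + h) y = 0 by rewrite repD -zy repM dy linear0 addr0.
by apply: inner_eq0; rewrite {1}/y rep_adj starD starM ds hs y0 inner0r.
Qed.

Lemma rep_selfadjoint_le s a (c : R) x : star a = a -> rnorm (s a) <= c ->
  inner (s a x) x <= c%:C * inner x x.
Proof.
move=> sa ac; have := inner_le (s a x) x.
have : inner (s a x) x = (inner (s a x) x)^*%C by rewrite -innerC -rep_star sa.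
case: (inner (s a x) x) => u v [/eqP]; rewrite eq_sym eqNr => /eqP ->.
rewrite inner_rnorm -rmorphM /= lecR /rnorm /= expr0n addr0 sqrtr_sqr => ule.
rewrite (le_trans (ler_norm _))// (le_trans ule)// expr2 mulrA.
rewrite ler_wpM2r ?rnorm_ge0// (le_trans (rnorm_bound _ _))//.
by rewrite ler_wpM2r ?rnorm_ge0.
Qed.

Lemma separating_eq0 (Delta : starRep A -> Prop) a : separating Delta ->
  (forall s, Delta s -> forall x, s a x = 0) -> a = 0.
Proof.
move=> sep a0; apply: sep; apply: functional_extensionality_dep => -[k kP].
apply: eq_exist; apply: functional_extensionality_dep => -[s Ds] /=.
by rewrite a0// rep0.
Qed.

Lemma min_spec_eigen (H : hilbertType R) (T : bounded_map H H) (m : R)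
    (l : R[i]) (x : H) :
  is_min_spec T m -> x != 0 -> T x = l *: x -> m%:C <= l.
Proof.
move=> [_ mmin] x0 Tx; apply: mmin => -[S /(_ x)[]].
by rewrite Tx subrr linear0 => xE; rewrite -xE eqxx in x0.
Qed.

Lemma l2_norm1 (H : hilbertType R) (x : 'I_1 -> H) :
  l2_norm x = rnorm (x ord0).
Proof. by rewrite /l2_norm big_ord1 sqrtr_sqr ger0_norm ?rnorm_ge0. Qed.

Lemma ampliation1 s a (x : 'I_1 -> rep_space s) :
  ampliation (const_mx a : 'M[A]_1) x ord0 = s a (x ord0).
Proof. by rewrite /ampliation big_ord1 mxE. Qed.

Lemma ampliation_norm_kernel s a : s a = 0 ->
  ampliation_norm s (const_mx a : 'M[A]_1) = 0.
Proof.
move=> a0; rewrite /ampliation_norm [X in sup X](_ : _ = [set 0 : R]) ?sup1//.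
apply/seteqP; split=> [_ [x _ <-]|_ ->] /=.
  by rewrite l2_norm1 ampliation1 a0 rnorm0.
exists (fun=> 0); rewrite /= l2_norm1 ?rnorm0//.
by rewrite ampliation1 linear0 rnorm0.
Qed.

Lemma ampliation_norm_unit s a (x : rep_space s) :
  x != 0 -> (forall y, s a y = y) ->
  ampliation_norm s (const_mx a : 'M[A]_1) = 1.
Proof.
move=> x0 a1; apply/eqP; rewrite eq_le; apply/andP; split.
  apply: ge_sup.
    by exists 0, (fun=> 0); rewrite /= l2_norm1 ?ampliation1 ?a1 rnorm0.
  by move=> _ [y /= y1 <-]; rewrite l2_norm1 ampliation1 a1 -l2_norm1.
apply: sup_upper_bound.
  split.
    by exists 0, (fun=> 0); rewrite /= l2_norm1 ?ampliation1 ?a1 rnorm0.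
  by exists 1 => _ [y /= y1 <-]; rewrite l2_norm1 ampliation1 a1 -l2_norm1.
have n1 : rnorm ((rnorm x)^-1%:C *: x) = 1.
  exact/rnorm_inner1/inner_normalize.
by exists (fun=> (rnorm x)^-1%:C *: x); rewrite /= l2_norm1 ?ampliation1 ?a1 n1.
Qed.

(** The element is [|h| + h], for [h] the element [t - c] scaled into the open
    unit ball, where absolute values were constructed.  If [pi] killed it, then
    [pi h] would be negative, against the existence of an eigenvector of [pi t],
    whose eigenvalue is at least [m]. *)
Lemma exists_separating_element pi t (c m : R) : star t = t ->
  irreducible pi -> finite_dimensional pi -> is_min_spec (pi t) m -> c < m ->
  exists2 b, pi b != 0 &
    forall s, irreducible s -> rnorm (s t) <= c -> s b = 0.
Proof.
move=> ts pi_irr pi_fin m_min cm.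
have unitE s l x : irreducible s -> s (l *: cunit) x = l *: x.
  by move=> s_irr; rewrite repZ rep_unit.
pose u := t - c%:C *: cunit.
have us : star u = u by rewrite starB starZ star1 ts /= oppr0.
pose k := (rnorm u + 1)^-1.
have k0 : 0 < k by rewrite invr_gt0 ltr_wpDl ?rnorm_ge0.
pose h := k%:C *: u.
have hs : star h = h by rewrite starZ us /= oppr0.
have h1 : rnorm h < 1.
  rewrite rnormZ (rnorm_real (ltW k0)) ltr_pdivrMl ?mulr1 ?ltrDl//.
  by rewrite ltr_wpDl ?rnorm_ge0.
have [d [ds hd dh]] := cstar_abs_sqrt hs h1.
have hE s x : irreducible s -> s h x = k%:C *: (s t x - c%:C *: x).
  by move=> s_irr; rewrite repZ repB unitE.
exists (cmul d d + h); last first.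
  move=> s s_irr sc; apply: rep_abs_neg => // x.
  rewrite hE// innerZl pmulr_rle0 ?ltcR// innerBl innerZl subr_le0.
  exact: rep_selfadjoint_le.
apply/negP => /eqP/rep_eq0 z0.
have [[a /rep_neq0[y ay]] _] := pi_irr; have [n [e esp]] := pi_fin.
have [//|//|//|l [x [_ x0 tx]]] :=
  @eigenvector_ex _ _ n e setT (pi t) (pi a y) esp _ _ _ ay.
have ml : m%:C <= l by apply: (min_spec_eigen m_min x0).
have : 0 < inner (pi h x) x.
  rewrite hE// tx -scalerBl !innerZl !mulr_gt0 ?ltcR//.
    by rewrite subr_gt0 (lt_le_trans _ ml)// ltcR.
  rewrite lt_def inner_ge0 andbT; apply: contra_neq x0; exact: inner_eq0.
have := z0 x; rewrite repD => /eqP.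
rewrite addr_eq0 eq_sym eqr_oppLR => /eqP ->.
rewrite -scaleN1r innerZl mulN1r repM -{1}ds rep_star oppr_gt0.
by rewrite le_gtF ?inner_ge0.
Qed.

End Separation.

Theorem theorem3p10 (R : realType) (A : cstarAlgType R)
    (Delta : starRep A -> Prop)
    (Delta_irr : forall s : starRep A, Delta s -> irreducible s)
    (Delta_sep : separating Delta)
    (t : A) (t_pos : positive t)
    (pi : starRep A) (pi_Delta : Delta pi) (pi_fin : finite_dimensional pi)
    (m : R) (m_min : is_min_spec (pi t) m)
    (gap : (ereal_sup [set r : \bar R | exists s : starRep A,
              [/\ Delta s, ~ weakly_equivalent s pi & r = (rnorm (s t))%:E]]
            < m%:E)%E) :
  exists p : A,
    is_support_projection pi (bidual_embedding p) /\
    peaks_strongly (const_mx p : 'M[A]_1) pi.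
Proof.
have pi_irr := Delta_irr pi pi_Delta.
have [c cm cP] : exists2 c, c < m & forall s, Delta s ->
    ~ weakly_equivalent s pi -> rnorm (s t) <= c.
  move: gap; set S := [set r | _] => gap.
  have Sle s : Delta s -> ~ weakly_equivalent s pi ->
      ((rnorm (s t))%:E <= ereal_sup S)%E.
    by move=> Ds sN; apply: ereal_sup_ubound; exists s.
  case: (ereal_sup S) gap Sle => [c cm Sle|//|_ Sle].
    by exists c => [|s Ds sN]; [rewrite -lte_fin|rewrite -lee_fin Sle].
  exists (m - 1) => [|s Ds sN]; first by rewrite ltrBlDr ltrDl.
  by have := Sle s Ds sN; rewrite leeNy_eq.
have [b pib bN] := exists_separating_element t_pos.1 pi_irr pi_fin m_min cm.
have [n [l [r lr]]] := ideal_contains_unit pi_irr pi_fin pib.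
pose p := \sum_i cmul (l i) (cmul b (r i)).
have p1 x : pi p x = x := lr x.
have pN s x : Delta s -> ~ weakly_equivalent s pi -> s p x = 0.
  move=> Ds sN; rewrite rep_sum big1// => i _.
  by rewrite !repM (bN s (Delta_irr s Ds) (cP s Ds sN)) linear0.
have pker a : (forall x, pi a x = 0) -> cmul p a = 0.
  move=> a0; apply: (separating_eq0 Delta_sep) => s Ds x; rewrite repM.
  have [sE|sN] := pselect (weakly_equivalent s pi); last exact: pN.
  have : [set a | s a = 0] a by rewrite sE /=; exact/rep_eq0.
  by move=> /= ->; rewrite linear0.
exists p; split; first exact: cover_support.
have [[a /rep_neq0[x ax]] _] := pi_irr.
rewrite /peaks_strongly (ampliation_norm_unit ax p1).
apply: (@le_lt_trans _ _ 0%E); last by rewrite lte_fin.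
apply: ge_ereal_sup => _ [s [s_irr sN ->]]; rewrite lee_fin.
rewrite ampliation_norm_kernel//; apply/eqP/negPn/negP => sp.
by apply: sN; exact: (cover_unitary pi_irr pi_fin p1 pker).
Qed.
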